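(* Let $V$ be a vector space, $(V,\vdash,[\cdot,\cdot])$ a Gel'fand-Dorfman algebra, and $R=\mathbb{C}[\partial]V$ the corresponding quadratic Lie conformal algebra. Let $\widehat{R}=R\oplus\mathbb{C}\mathfrak{c}$ be a Leibniz central extension of $R$ by a one-dimensional center $\mathbb{C}\mathfrak{c}$, with $\lambda$-bracket $$\widetilde{[a_\lambda b]}=\partial(a\vdash b)+\lambda(a\vdash b+b\vdash a)+[a,b]+\alpha_\lambda(a,b)\mathfrak{c},\qquad a,b\in V,$$ where $\alpha_\lambda(a,b)\in\mathbb{C}[\lambda]$. Assume that $\alpha_\lambda(a,b)=\sum_{i=0}^n\lambda^i\alpha_i(a,b)$ for all $a,b\in V$, where all $\alpha_i(\cdot,\cdot):V\times V\to\mathbb{C}$ are bilinear forms and there exist $a,b\in V$ with $\alpha_n(a,b)\neq 0$. Then for all $a,b,c\in V$: (1) If $n>3$, then $\alpha_n(a\vdash b,c)=0$. (2) If $n\le 3$, then $\alpha_\lambda(a,b)=\sum_{i=0}^3\lambda^i\alpha_i(a,b)$ (with $\alpha_i=0$ for $i>n$) and $\alpha_\lambda(\cdot,\cdot)$ satisfies \begin{align*} &(\lambda+\mu)\alpha_\lambda(a,b\vdash c)+\mu\alpha_\lambda(a,c\vdash b)+\alpha_\lambda(a,[b,c])\\ &\quad=-\mu\alpha_{\lambda+\mu}(a\vdash b,c)+\lambda\alpha_{\lambda+\mu}(b\vdash a,c)+\alpha_{\lambda+\mu}([a,b],c)\\ &\qquad+(\lambda+\mu)\alpha_\mu(b,a\vdash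 c)+\lambda\alpha_\mu(b,c\vdash a)+\alpha_\mu(b,[a,c]). \end{align*} (3) Two such 2-cocycles $\alpha_\lambda(\cdot,\cdot)$ and $\alpha'_\lambda(\cdot,\cdot)$ are equivalent if and only if there exists a linear map $\varphi:V\to\mathbb{C}$ such that $$\alpha_\lambda(a,b)=\alpha'_\lambda(a,b)+\lambda\varphi(a\vdash b+b\vdash a)+\varphi([a,b])\quad\text{for all }a,b\in V.$$
   Context: All vector spaces are over $\mathbb{C}$. A Novikov algebra is a vector space $A$ with a bilinear operation $\circ$ satisfying $a\circ(b\circ c)=b\circ(a\circ c)$ and $(a\circ b)\circ c-a\circ(b\circ c)=(a\circ c)\circ b-a\circ(c\circ b)$. A Gel'fand-Dorfman algebra $(A,\circ,[\cdot,\cdot])$ is a vector space such that $(A,[\cdot,\cdot])$ is a Lie algebra, $(A,\circ)$ is a Novikov algebra and $a\circ[b,c]+[a,b\circ c]=b\circ[a,c]+[b,a\circ c]+[a,b]\circ c$ for all $a,b,c$. A conformal algebra is a $\mathbb{C}[\partial]$-module $R$ with a $\mathbb{C}$-bilinear map $R\times R\to R[\lambda]$, $(a,b)\mapsto[a_\lambda b]$, with $[\partial a_\lambda b]=-\lambda[a_\lambda b]$, $[a_\lambda\partial b]=(\partial+\lambda)[a_\lambda b]$. It is a Leibniz conformal algebra if $[a_\lambda[b_\mu c]]=[[a_\lambda b]_{\lambda+\mu}c]+[b_\mu[a_\lambda c]]$, and a Lie conformal algebra if moreover $[a_\lambda b]=-[b_{-\lambda-\partial}a]$. The quadratic Lie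 conformal algebra corresponding to a Gel'fand-Dorfman algebra $(V,\vdash,[\cdot,\cdot])$ is the free $\mathbb{C}[\partial]$-module $R=\mathbb{C}[\partial]V$ with $[a_\lambda b]=\partial(a\vdash b)+\lambda(a\vdash b+b\vdash a)+[a,b]$ for $a,b\in V$, extended by sesquilinearity. A Leibniz central extension $\widehat R=R\oplus\mathbb{C}\mathfrak{c}$ of a Lie conformal algebra $R$ by the one-dimensional center $\mathbb{C}\mathfrak{c}$ is a Leibniz conformal algebra (not necessarily Lie) with $\partial\mathfrak{c}=0$, $\mathfrak{c}$ central, and $[a_\lambda b]_{\widehat R}=[a_\lambda b]_R+\alpha_\lambda(a,b)\mathfrak{c}$ for $a,b\in R$, where $\alpha_\lambda:R\times R\to\mathbb{C}[\lambda]$ is $\mathbb{C}$-bilinear. Then $\alpha_\lambda$ is a 2-cocycle, i.e. $\alpha_\lambda(\partial a,b)=-\lambda\alpha_\lambda(a,b)=-\alpha_\lambda(a,\partial b)$ and $\alpha_\lambda(a,[b_\mu c])=\alpha_{\lambda+\mu}([a_\lambda b],c)+\alpha_\mu(b,[a_\lambda c])$. Two 2-cocycles $\alpha,\alpha'$ are equivalent if there is a $\mathbb{C}[\partial]$-module homomorphism $\varphi:R\to\mathbb{C}$ (with $\mathbb{C}$ the trivial module, $\partial$ acting by $0$) such that $\alpha_\lambda(a,b)=\alpha'_\lambda(a,b)+\varphi([a_\lambda b])$ for all $a,b\in R$ (where $\varphi$ is extended coefficientwise in $\lambda$). *)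

(* Defs.v *)
From HB Require Import structures.
From mathcomp Require Import all_boot all_order all_algebra.
From mathcomp Require Import polyXY sesquilinear finmap.
From mathcomp Require Import reals complex.
From mathcomp Require Import monalg.

Set Implicit Arguments.
Unset Strict Implicit.
Unset Printing Implicit Defensive.

Import GRing.Theory.

Local Open Scope ring_scope.

(* [vpoly M] is the module M[X] of polynomials in one indeterminate with
   coefficients in a module M.  It serves as M[λ] for the values of a
   λ-bracket, as M[λ][μ] (inner indeterminate λ, outer indeterminate μ) for
   the Jacobi identity, and as the free K[∂]-module K[∂]V = V[∂].  It is a
   new type because {malg M[nat]} is an lmodType only for a ring M. *)
Definition vpoly (M : zmodType) := {malg M[nat]}.
HB.instance Definition _ (M : zmodType) :=
  GRing.Zmodule.copy (vpoly M) {malg M[nat]}.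

HB.lock Definition vmono (M : zmodType) (i : nat) (m : M) : vpoly M :=
  << m *g i >>.

Definition vconst (M : zmodType) (m : M) : vpoly M := vmono 0 m.

(* vsum f (\sum_i m_i X^i) = \sum_i f i m_i, for f such that f i 0 = 0 *)
HB.lock Definition vsum (M N : zmodType) (f : nat -> M -> N) (p : vpoly M) : N :=
  \sum_(i <- msupp p) f i p@_i.

Definition vX (M : zmodType) (p : vpoly M) : vpoly M :=
  vsum (fun i => vmono i.+1) p.

Definition vmap (M N : zmodType) (f : M -> N) (p : vpoly M) : vpoly N :=
  vsum (fun i m => vmono i (f m)) p.

Lemma vsumEw (M N : zmodType) (f : nat -> M -> N) (p : vpoly M) d :
  (forall i, f i 0 = 0) -> (msupp p `<=` d)%fset ->
  vsum f p = \sum_(i <- d) f i p@_i.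
Proof.
move=> f0 le; rewrite vsum.unlock (big_fset_incl _ le) //= => i _ ni.
by rewrite mcoeff_outdom.
Qed.

Lemma vmap_coef (M N : zmodType) (f : M -> N) (p : vpoly M) i :
  f 0 = 0 -> (vmap f p)@_i = f p@_i.
Proof.
move=> f0; rewrite /vmap (@vsumEw _ _ _ _ (i |` msupp p)%fset) ?fsubsetUr //; last first.
  by move=> j; rewrite vmono.unlock f0 monalgU0.
rewrite vmono.unlock raddf_sum /= (big_fsetD1 i) ?fset1U1 //= mcoeffUU big1_seq ?addr0 //.
by move=> j /andP[_]; rewrite !inE => /andP[/negPf nj _]; rewrite mcoeffU nj.
Qed.

Section VpolyLmodule.
Variables (K : pzRingType) (M : lmodType K).

Definition vscale (c : K) (p : vpoly M) : vpoly M := vmap ( *:%R c) p.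

Lemma vscale_coef c p i : (vscale c p)@_i = c *: p@_i.
Proof. by rewrite vmap_coef // scaler0. Qed.

Lemma vscalerA a b p : vscale a (vscale b p) = vscale (a * b) p.
Proof. by apply/malgP=> i; rewrite !vscale_coef scalerA. Qed.

Lemma vscale1r : left_id 1 vscale.
Proof. by move=> p; apply/malgP=> i; rewrite vscale_coef scale1r. Qed.

Lemma vscalerDr : right_distributive vscale +%R.
Proof.
move=> c p q; apply/malgP=> i.
by rewrite mcoeffD !vscale_coef mcoeffD scalerDr.
Qed.

Lemma vscalerDl p : {morph vscale^~ p : a b / a + b}.
Proof.
by move=> a b; apply/malgP=> i; rewrite mcoeffD !vscale_coef scalerDl.
Qed.

HB.instance Definition _ :=
  GRing.Zmodule_isLmodule.Build K (vpoly M)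
    vscalerA vscale1r vscalerDr vscalerDl.

End VpolyLmodule.

Section GelfandDorfman.
Variables (K : nzRingType) (V : lmodType K).

Record is_novikov (op : V -> V -> V) : Prop := IsNovikov {
  novikov_bilinear : bilinear_for *:%R *:%R op;
  novikov_lcomm : forall a b c, op a (op b c) = op b (op a c);
  novikov_rsym : forall a b c,
    op (op a b) c - op a (op b c) = op (op a c) b - op a (op c b)
}.

Record is_lie (lie : V -> V -> V) : Prop := IsLie {
  lie_bilinear : bilinear_for *:%R *:%R lie;
  lie_alternating : forall a, lie a a = 0;
  lie_jacobi : forall a b c,
    lie a (lie b c) + lie b (lie c a) + lie c (lie a b) = 0
}.

Record is_gelfand_dorfman (op lie : V -> V -> V) : Prop := IsGelfandDorfman {
  gd_lie : is_lie lie;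
  gd_novikov : is_novikov op;
  gd_compat : forall a b c,
    op a (lie b c) + lie a (op b c) =
    op b (lie a c) + lie b (op a c) + op (lie a b) c
}.

End GelfandDorfman.

(* A K[∂]-module is given as a K-module M with a linear endomorphism D, the
   action of ∂; a λ-bracket is a map br : M -> M -> M[λ]. *)
Section Conformal.
Variables (K : nzRingType) (M : lmodType K) (D : M -> M).
Variable br : M -> M -> vpoly M.

Record is_conformal : Prop := IsConformal {
  conformal_D_linear : linear D;
  conformal_bilinear : bilinear_for *:%R *:%R br;
  conformal_Dl : forall a b, br (D a) b = - vX (br a b);
  conformal_Dr : forall a b, br a (D b) = vmap D (br a b) + vX (br a b)
}.

(* multiplication by λ and by μ on M[λ][μ] *)
Definition mul_lambda : vpoly (vpoly M) -> vpoly (vpoly M) := vmap (@vX M).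
Definition mul_mu : vpoly (vpoly M) -> vpoly (vpoly M) := @vX (vpoly M).

(* p(ν) in M[ν]  |->  p(λ + μ) in M[λ][μ] *)
Definition subst_lambda_mu (p : vpoly M) : vpoly (vpoly M) :=
  vsum (fun k m => iter k (fun u => mul_lambda u + mul_mu u)
                     (vconst (vconst m))) p.

(* [a_λ [b_μ c]] *)
Definition br_lambda_mu (a b c : M) : vpoly (vpoly M) :=
  vmap (br a) (br b c).

(* [b_μ [a_λ c]] *)
Definition br_mu_lambda (b a c : M) : vpoly (vpoly M) :=
  vsum (fun i m => vmap (vmono i) (br b m)) (br a c).

(* [[a_λ b]_{λ+μ} c] *)
Definition br_left (a b c : M) : vpoly (vpoly M) :=
  vsum (fun i m => iter i mul_lambda (subst_lambda_mu (br m c))) (br a b).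

Definition is_leibniz_conformal : Prop :=
  is_conformal /\
  forall a b c, br_lambda_mu a b c = br_left a b c + br_mu_lambda b a c.

End Conformal.

Section Quadratic.
Variables (K : nzRingType) (V : lmodType K) (op lie : V -> V -> V).

(* ∂(a ⊢ b) + λ(a ⊢ b + b ⊢ a) + [a, b], for a, b in V, in V[∂][λ] *)
Definition quad_bracket_gen (a b : V) : vpoly (vpoly V) :=
  vconst (vX (vconst (op a b))) + vX (vconst (vconst (op a b + op b a)))
  + vconst (vconst (lie a b)).

(* [∂^i a _λ ∂^j b] = (-λ)^i (∂ + λ)^j [a_λ b] *)
Definition quad_bracket (p q : vpoly V) : vpoly (vpoly V) :=
  vsum (fun i a =>
    vsum (fun j b =>
      iter i (fun u => - vX u)
        (iter j (fun u => vmap (@vX V) u + vX u) (quad_bracket_gen a b))) q) p.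

End Quadratic.

Section CentralExtension.
Variables (K : nzRingType) (M : lmodType K) (D : M -> M).
Variable br : M -> M -> vpoly M.

(* The central extension lives on M * K^o, where (0, 1) is the central
   element, killed by ∂. *)
Definition ext_D (u : M * K^o) : M * K^o := (D u.1, 0).

Definition ext_bracket (alpha : M -> M -> {poly K}) (u v : M * K^o) :
    vpoly (M * K^o)%type :=
  vmap (fun m : M => (m, 0 : K^o)) (br u.1 v.1)
  + \sum_(i < size (alpha u.1 v.1)) vmono i (0 : M, (alpha u.1 v.1)`_i : K^o).

Definition is_leibniz_central_ext (alpha : M -> M -> {poly K}) : Prop :=
  bilinear_for *:%R *:%R alpha /\
  is_leibniz_conformal ext_D (ext_bracket alpha).

Definition map_form (phi : M -> K) (p : vpoly M) : {poly K} :=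
  vsum (fun i m => phi m *: 'X^i) p.

Definition cocycle_equiv (alpha alpha' : M -> M -> {poly K}) : Prop :=
  exists phi : {scalar M},
    (forall a, phi (D a) = 0) /\
    (forall a b, alpha a b = alpha' a b + map_form phi (br a b)).

End CentralExtension.

(* K[λ, μ] is {poly {poly K}} with inner indeterminate λ and outer
   indeterminate μ; [at_lambda p], [at_mu p], [at_lambda_mu p] are p(λ), p(μ)
   and p(λ + μ). *)
Notation lambda := ('X%:P).
Notation mu := ('X).
Notation at_lambda p := (polyC p).
Notation at_mu p := (map_poly polyC p).
Notation at_lambda_mu p := (poly_XaY p).

(* Main.v *)
Require Import Defs.
From HB Require Import structures.
From mathcomp Require Import all_boot all_order all_algebra.
From mathcomp Require Import polyXY sesquilinear reals complex.
From mathcomp Require Import finmap monalg zify ring.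

Set Implicit Arguments.
Unset Strict Implicit.
Unset Printing Implicit Defensive.

Import GRing.Theory.
Local Open Scope ring_scope.

(** The 2-cocycle of a Leibniz central extension is the central coordinate of
the extended bracket.  Reading the sesquilinearity and the Jacobi identity of
the extension in that coordinate gives the sesquilinearity of [alpha]
([cocycle_conformal_form]) and the 2-cocycle identity ([cocycle_identity]);
reading sesquilinearity in the other coordinate gives it for the bracket of the
base.

For [a] and [b] in [V], the bracket of [a] and [b] has degree at most 1 in λ and
in ∂, and sesquilinearity turns ∂ inside [alpha] into a multiplication by the
spectral parameter, up to sign.  The
cocycle identity then becomes the functional equation of the statement
([quadratic_cocycle_identity]), whatever the degree of [alpha] in λ.

For the vanishing when [n > 3], take the part of total degree [n + 1] in λ and
μ of this equation.  Write [x] and [y] for the coefficients of λ^n in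
[alpha (a ⊢ b, c)] and [alpha (b ⊢ a, c)].  The terms that involve only λ or
only μ through [alpha] are divisible by λ^n or by μ^n, so in the middle range
only the (λ+μ)-terms survive, and the coefficient of λ^(n-j) μ^(j+1) gives
[binom(n, j) x = binom(n, j + 1) y] ([top_coef_eq]).  As soon as [n >= 4] there
are at least two such relations, and those with [j = n - 2] and [j = n - 3] are
independent because [n binom(n, 3) < binom(n, 2)^2]; hence [x = 0]
([top_coef_eq0]).

For the equivalence, a map of K[∂]-modules from [V[∂]] to the trivial module
factors through the constant term, so it is a linear form on [V].  Both sides of
the equation defining equivalence are additive and sesquilinear, hence are
determined by their values on [V] ([conformal_form_ext]), where the equation
is the one of the statement. *)

(** * Additive maps and polynomials with coefficients in a module *)

Lemma morphD0 (U W : zmodType) (f : U -> W) :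
  {morph f : x y / x + y} -> f 0 = 0.
Proof. by move=> fD; apply: (addrI (f 0)); rewrite -fD !addr0. Qed.

Lemma morphDN (U W : zmodType) (f : U -> W) :
  {morph f : x y / x + y} -> {morph f : x / - x}.
Proof.
by move=> fD x; apply: (addrI (f x)); rewrite -fD !subrr morphD0.
Qed.

Lemma linear_for_morphD (K : nzRingType) (U : lmodType K) (W : zmodType)
    (s : GRing.Scale.law K W) (f : U -> W) :
  GRing.linear_for (s : K -> W -> W) f -> {morph f : x y / x + y}.
Proof.
move=> fL; pose F : {linear U -> W | s} :=
  HB.pack f (GRing.isLinear.Build K U W s f fL).
exact: (raddfD F).
Qed.

Lemma vmono_coef (M : zmodType) i (m : M) j :
  (vmono i m)@_j = if i == j then m else 0.
Proof. by rewrite vmono.unlock mcoeffU mulrb. Qed.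

Lemma vmonoD (M : zmodType) i : {morph @vmono M i : x y / x + y}.
Proof. by move=> x y; rewrite vmono.unlock monalgUD. Qed.

Section Vsum.
Variables (M N : zmodType).

Lemma vsumD (g : nat -> M -> N) :
  (forall i, {morph g i : x y / x + y}) -> {morph vsum g : p q / p + q}.
Proof.
move=> gD p q; have g0 i : g i 0 = 0 by exact: morphD0.
set d := (msupp p `|` msupp q)%fset.
rewrite (@vsumEw _ _ g (p + q) d) ?msuppD_le // (@vsumEw _ _ g p d) ?fsubsetUl //.
rewrite (@vsumEw _ _ g q d) ?fsubsetUr // -big_split.
by apply: eq_bigr => i _; rewrite mcoeffD gD.
Qed.

Lemma vsum_mono (g : nat -> M -> N) i m :
  (forall j, g j 0 = 0) -> vsum g (vmono i m) = g i m.
Proof.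
move=> g0; rewrite (@vsumEw _ _ g _ [fset i]%fset) //; last first.
  by rewrite vmono.unlock msuppU_le.
by rewrite big_seq_fset1 vmono_coef eqxx.
Qed.

Lemma vsum_comp (P : zmodType) (F : N -> P) (g : nat -> M -> N) p :
  {morph F : x y / x + y} -> F (vsum g p) = vsum (fun i m => F (g i m)) p.
Proof.
by move=> FD; rewrite vsum.unlock (big_morph F FD (morphD0 FD)).
Qed.

Lemma eq_vsum (g h : nat -> M -> N) p :
  (forall i m, g i m = h i m) -> vsum g p = vsum h p.
Proof. by move=> gh; rewrite vsum.unlock; apply: eq_bigr. Qed.

End Vsum.

Lemma vsum_map (M N P : zmodType) (f : nat -> N -> P) (g : M -> N) p :
  (forall i, {morph f i : x y / x + y}) ->
  vsum f (vmap g p) = vsum (fun i m => f i (g m)) p.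
Proof.
move=> fD; rewrite /vmap vsum_comp; last exact: vsumD.
by apply: eq_vsum => i m; rewrite vsum_mono // => j; apply: morphD0.
Qed.

Lemma vpoly_sum (M : zmodType) (p : vpoly M) :
  p = vsum (fun i m => vmono i m) p.
Proof. by rewrite vsum.unlock vmono.unlock [LHS]monalgE. Qed.

(** Induction along the generation of [M[X]] by [M] as an abelian group with
the operator X. *)
Lemma vpoly_ind (M : zmodType) (P : vpoly M -> Prop) :
  P 0 -> (forall p q, P p -> P q -> P (p + q)) ->
  (forall m, P (vconst m)) -> (forall p, P p -> P (vX p)) -> forall p, P p.
Proof.
move=> P0 PD PC PX p; rewrite (vpoly_sum p) vsum.unlock.
apply: (big_ind P) => // i _; elim: i (p@_i) => [|i IH] m; first exact: PC.
have -> : vmono i.+1 m = vX (vmono i m).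
  by rewrite /vX vsum_mono // => j; apply: morphD0 (vmonoD _).
exact/PX/IH.
Qed.

Lemma vX_coef (M : zmodType) (p : vpoly M) i :
  (vX p)@_i = if i is j.+1 then p@_j else 0.
Proof.
rewrite /vX vsum_comp; last by move=> x y; rewrite mcoeffD.
transitivity (vsum (fun k m => if k.+1 == i then m else 0) p).
  by apply: eq_vsum => k m; rewrite vmono_coef.
case: i => [|i].
  by rewrite vsum.unlock big1.
rewrite [in RHS](vpoly_sum p) [RHS]vsum_comp; last by move=> x y; rewrite mcoeffD.
by apply: eq_vsum => k m; rewrite vmono_coef.
Qed.

Lemma vXD (M : zmodType) : {morph @vX M : p q / p + q}.
Proof. by move=> p q; apply/malgP => -[|i]; rewrite !(vX_coef, mcoeffD) ?addr0. Qed.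

Lemma vmapD (M N : zmodType) (f : M -> N) :
  {morph f : x y / x + y} -> {morph vmap f : p q / p + q}.
Proof.
move=> fD p q; have f0 := morphD0 fD.
by apply/malgP => i; rewrite !(vmap_coef, mcoeffD).
Qed.

(** * From module coefficients to ring coefficients *)

(** Additive maps to a ring turn the formal polynomials in which brackets take
their values into ordinary polynomials, where a product is available; applied
twice, [vform] goes from [M[λ][μ]] to [A[λ][μ]]. *)
Definition vform (M : zmodType) (A : nzRingType) (f : M -> A) (p : vpoly M) :
  {poly A} := vsum (fun i m => f m *: 'X^i) p.

Section Vform.
Variables (M : zmodType) (A : nzRingType).
Implicit Types (f : M -> A) (p : vpoly M).

Lemma vform_coef f p i : f 0 = 0 -> (vform f p)`_i = f p@_i.
Proof.
move=> f0; rewrite /vform (@vsumEw _ _ _ _ (i |` msupp p)%fset) ?fsubsetUr //; last first.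
  by move=> j; rewrite f0 scale0r.
rewrite coef_sum (big_fsetD1 i) ?fset1U1 //= coefZ coefXn eqxx mulr1.
rewrite big1_seq ?addr0 // => j /andP[_]; rewrite !inE => /andP[nj _].
by rewrite coefZ coefXn eq_sym (negPf nj) mulr0.
Qed.

Lemma vformD f : {morph f : x y / x + y} -> {morph vform f : p q / p + q}.
Proof.
move=> fD p q; have f0 := morphD0 fD.
by apply/polyP => i; rewrite coefD !vform_coef // mcoeffD fD.
Qed.

Lemma vform_mono f i m : f 0 = 0 -> vform f (vmono i m) = f m *: 'X^i.
Proof. by move=> f0; rewrite /vform vsum_mono // => j; rewrite f0 scale0r. Qed.

Lemma vform_const f m : f 0 = 0 -> vform f (vconst m) = (f m)%:P.
Proof. by move=> f0; rewrite vform_mono // expr0 alg_polyC. Qed.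

Lemma vform_vX f p : f 0 = 0 -> vform f (vX p) = vform f p * 'X.
Proof.
move=> f0; apply/polyP => i; rewrite coefMX !vform_coef // vX_coef.
by case: i => [|i] //=; rewrite vform_coef.
Qed.

End Vform.

Lemma vform_map (M N : zmodType) (A : nzRingType) (g : N -> M) (f : M -> A)
    (p : vpoly N) :
  g 0 = 0 -> f 0 = 0 -> vform f (vmap g p) = vform (fun n => f (g n)) p.
Proof.
by move=> g0 f0; apply/polyP => i; rewrite !vform_coef ?vmap_coef ?g0.
Qed.

(** * The polynomial p(λ + μ) *)

Lemma coef_exprXaY (K : comNzRingType) k i j :
  ((mu + lambda : {poly {poly K}}) ^+ k)`_j`_i =
  (k == i + j)%N%:R *+ 'C(i + j, j).
Proof.
rewrite addrC exprDn !coef_sum /=.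
under eq_bigr => l _ do
  rewrite -polyC_exp coefMn coefCM coefXn coefMn mulr_natr coefMn coefXn.
have [le_jk|lt_kj] := leqP j k; last first.
  rewrite big1 => [|l _]; last first.
    have /gtn_eqF -> : (l < j)%N by apply: leq_ltn_trans lt_kj; rewrite -ltnS.
    by rewrite mul0rn.
  by rewrite ltn_eqF ?mul0rn // (leq_trans lt_kj) ?leq_addl.
have lt_jk : (j < k.+1)%N by [].
rewrite (bigD1 (Ordinal lt_jk)) //= eqxx mulr1n big1 ?addr0 => [|l nl]; last first.
  by rewrite eq_sym -val_eqE /= in nl *; rewrite (negPf nl) mulr0n mul0rn.
have [->|ne] := eqVneq k (i + j)%N; first by rewrite addnK eqxx.
case: eqP => [e|_]; last by rewrite !mul0rn.
by rewrite e subnK ?eqxx in ne.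
Qed.

Lemma poly_XaYE (K : comNzRingType) (p : {poly K}) :
  poly_XaY p = \sum_(k < size p) (p`_k)%:P *: (mu + lambda) ^+ k.
Proof.
by rewrite /poly_XaY comp_polyE size_map_polyC; apply: eq_bigr => k _; rewrite coef_map.
Qed.

Lemma coef_poly_XaY (K : comNzRingType) (p : {poly K}) i j :
  (poly_XaY p)`_j`_i = p`_(i + j)%N *+ 'C(i + j, j).
Proof.
rewrite poly_XaYE !coef_sum.
under eq_bigr => k _ do rewrite coefZ coefCM coef_exprXaY.
have [lt_p|le_p] := ltnP (i + j) (size p).
  rewrite (bigD1 (Ordinal lt_p)) //= eqxx mulr_natr big1 ?addr0 // => k nk.
  by rewrite -val_eqE /= in nk; rewrite (negPf nk) mul0rn mulr0.
rewrite nth_default // mul0rn big1 // => k _.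
by rewrite ltn_eqF ?mul0rn ?mulr0 // (leq_trans (ltn_ord k)).
Qed.

Lemma poly_XaYD (K : comNzRingType) :
  {morph poly_XaY (R := K) : p q / p + q}.
Proof.
by move=> p q; rewrite /poly_XaY rmorphD comp_polyD.
Qed.

Lemma poly_XaY_N_MX (K : comNzRingType) (p : {poly K}) :
  poly_XaY (- (p * 'X)) = - (poly_XaY p * (mu + lambda)).
Proof.
rewrite /poly_XaY rmorphN /= rmorphM /= map_polyX.
by rewrite [LHS]rmorphN /= comp_polyM comp_polyX.
Qed.

(** * Sesquilinear forms *)

(** The rules that the two kinds of forms to be compared, cocycles and
coboundaries, have in common.  ∂ acts by 0 on the values, which is why the rule
for the right argument has no ∂-term. *)
Definition conformal_form (K : nzRingType) (M : zmodType) (D : M -> M)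
    (f : M -> M -> {poly K}) : Prop :=
  [/\ forall b, {morph f^~ b : x y / x + y},
      forall a, {morph f a : x y / x + y},
      forall a b, f (D a) b = - (f a b * 'X)
    & forall a b, f a (D b) = f a b * 'X].

Lemma conformal_formD (K : nzRingType) (M : zmodType) (D : M -> M)
    (f g : M -> M -> {poly K}) :
  conformal_form D f -> conformal_form D g ->
  conformal_form D (fun a b => f a b + g a b).
Proof.
move=> [fDl fDr fXl fXr] [gDl gDr gXl gXr].
split=> [b x y|a x y|a b|a b] /=.
- by rewrite fDl gDl addrACA.
- by rewrite fDr gDr addrACA.
- by rewrite fXl gXl mulrDl opprD.
- by rewrite fXr gXr mulrDl.
Qed.

(** * The cocycle of a central extension *)

Section CentralExtension.
Variables (K : comNzRingType) (M : lmodType K) (D : M -> M).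
Variables (br : M -> M -> vpoly M) (alpha : M -> M -> {poly K}).
Hypothesis ext : is_leibniz_central_ext D br alpha.

Local Notation N := (M * K^o)%type.
Local Notation E := (ext_bracket br alpha).
Local Notation psi := (fun u : N => u.2 : K).

Let psiD : {morph psi : x y / x + y}. Proof. by []. Qed.

Lemma ext_bracket_coef u v i :
  (E u v)@_i = ((br u.1 v.1)@_i, (alpha u.1 v.1)`_i).
Proof.
rewrite /ext_bracket mcoeffD vmap_coef // raddf_sum /=.
under eq_bigr do rewrite vmono_coef.
rewrite [LHS]surjective_pairing; congr (_, _) => /=.
  rewrite (big_morph (fun u : N => u.1) (fun _ _ => erefl) erefl) big1 ?addr0 //.
  by move=> j _; case: eqP.
rewrite add0r (big_morph psi (fun _ _ => erefl) erefl).
case: (ltnP i (size (alpha u.1 v.1))) => [lt_i|le_i].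
  rewrite (bigD1 (Ordinal lt_i)) //= eqxx big1 ?addr0 // => j nj.
  by rewrite -val_eqE /= in nj; rewrite (negPf nj).
rewrite nth_default // big1 // => j _; rewrite ifN //.
by rewrite neq_ltn (leq_trans (ltn_ord j)).
Qed.

Lemma vform_ext_bracket u v : vform psi (E u v) = alpha u.1 v.1.
Proof. by apply/polyP => i; rewrite vform_coef // ext_bracket_coef. Qed.

Lemma cocycleDl b : {morph alpha^~ b : x y / x + y}.
Proof. by have [+ _] := ext => -[aL _]; exact: linear_for_morphD. Qed.

Lemma cocycleDr a : {morph alpha a : x y / x + y}.
Proof. by have [+ _] := ext => -[_ aL]; exact: linear_for_morphD. Qed.

Lemma cocycle_Dl a b : alpha (D a) b = - (alpha a b * 'X).
Proof.
have [_ [[_ _ EDl _] _]] := ext.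
have /(congr1 (vform psi)) := EDl (a, 0) (b, 0).
rewrite vform_ext_bracket /= => ->.
apply/polyP => i; rewrite coefN vform_coef // mcoeffN coefMX vX_coef.
by case: i => [|i]; rewrite ?ext_bracket_coef /= ?oppr0.
Qed.

Lemma cocycle_Dr a b : alpha a (D b) = alpha a b * 'X.
Proof.
have [_ [[DL _ _ EDr] _]] := ext.
have D0 : ext_D D 0 = 0 :> N.
  exact: morphD0 (linear_for_morphD (s := *:%R) DL).
have /(congr1 (vform psi)) := EDr (a, 0) (b, 0).
rewrite vform_ext_bracket /= => ->.
rewrite vformD // vform_map // vform_vX // vform_ext_bracket -[RHS]add0r.
by congr (_ + _); apply/polyP => i; rewrite vform_coef // coef0.
Qed.

(** The bracket of the base is a quotient of that of the extension, and
inherits its properties from there. *)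
Let brE a b : br a b = vmap (fun u : N => u.1) (E (a, 0) (b, 0)).
Proof. by apply/malgP => i; rewrite vmap_coef // ext_bracket_coef. Qed.

Let ext_bracketDl v : {morph E^~ v : u w / u + w}.
Proof. by have [_ [[_ [EL _] _ _] _]] := ext; exact: linear_for_morphD. Qed.

Let ext_bracketDr u : {morph E u : v w / v + w}.
Proof. by have [_ [[_ [_ EL] _ _] _]] := ext; exact: linear_for_morphD. Qed.

Lemma bracketDl b : {morph br^~ b : x y / x + y}.
Proof.
move=> x y; rewrite !brE -vmapD // -ext_bracketDl.
by congr (vmap _ (E _ _)); congr (_, _); rewrite addr0.
Qed.

Lemma bracketDr a : {morph br a : x y / x + y}.
Proof.
move=> x y; rewrite !brE -vmapD // -ext_bracketDr.
by congr (vmap _ (E _ _)); congr (_, _); rewrite addr0.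
Qed.

Lemma bracket_Dl a b : br (D a) b = - vX (br a b).
Proof.
have [_ [[_ _ EDl _] _]] := ext.
rewrite (brE (D a)) [E _ _](EDl (a, 0) (b, 0)); apply/malgP => i.
rewrite vmap_coef // !mcoeffN !vX_coef.
by case: i => [|i] //; rewrite ext_bracket_coef.
Qed.

Lemma bracket_Dr a b : br a (D b) = vmap D (br a b) + vX (br a b).
Proof.
have [_ [[DL _ _ EDr] _]] := ext.
have D0 : ext_D D 0 = 0 :> N.
  exact: morphD0 (linear_for_morphD (s := *:%R) DL).
rewrite (brE a (D b)) [E _ _](EDr (a, 0) (b, 0)); apply/malgP => i.
rewrite vmap_coef // !mcoeffD !vX_coef (vmap_coef _ _ D0) ext_bracket_coef.
rewrite vmap_coef; last by have := congr1 fst D0.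
by case: i => [|i] //; rewrite ext_bracket_coef.
Qed.

Lemma cocycle_conformal_form : conformal_form D alpha.
Proof.
by split; [exact: cocycleDl|exact: cocycleDr|exact: cocycle_Dl|exact: cocycle_Dr].
Qed.

(** A functional that kills ∂ sends the sesquilinear bracket to a form of the
same type as a cocycle, so the two can be compared on generators. *)
Lemma coboundary_conformal_form (phi : M -> K) :
  {morph phi : x y / x + y} -> (forall a, phi (D a) = 0) ->
  conformal_form D (fun a b => vform phi (br a b)).
Proof.
move=> phiD phi_D; have phi0 := morphD0 phiD.
have [_ [[DL _ _ _] _]] := ext.
have D0 : D 0 = 0.
  by have /(congr1 fst) := morphD0 (linear_for_morphD (s := *:%R) DL).
split=> [b x y|a x y|a b|a b].
- by rewrite bracketDl vformD.
- by rewrite bracketDr vformD.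
- by rewrite bracket_Dl (morphDN (vformD phiD)) vform_vX.
- rewrite bracket_Dr vformD // vform_vX // vform_map // -[RHS]add0r.
  by congr (_ + _); apply/polyP => i; rewrite vform_coef // coef0.
Qed.

Local Notation psi2 := (vform (vform psi)).

Let psi2D : {morph psi2 : P Q / P + Q}.
Proof. by do 2!apply: vformD. Qed.

Let vpsi0 : vform psi 0 = 0.
Proof. exact/morphD0/vformD. Qed.

Lemma vform_mul_lambda (P : vpoly (vpoly N)) :
  psi2 (mul_lambda P) = lambda * psi2 P.
Proof.
rewrite vform_map //; last exact/morphD0/vXD.
apply/polyP => j; rewrite coefCM vform_coef ?vform_coef //.
  by rewrite vform_vX // mulrC.
by rewrite vform_vX // vpsi0 mul0r.
Qed.

Lemma vform_mul_mu (P : vpoly (vpoly N)) : psi2 (mul_mu P) = mu * psi2 P.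
Proof. by rewrite vform_vX // mulrC. Qed.

Lemma vform_subst_lambda_mu (p : vpoly N) :
  psi2 (subst_lambda_mu p) = at_lambda_mu (vform psi p).
Proof.
rewrite /subst_lambda_mu vsum_comp // [in RHS](vpoly_sum p).
rewrite (vsum_comp (F := fun q => at_lambda_mu (vform psi q))); last first.
  by move=> q r; rewrite vformD // poly_XaYD.
apply: eq_vsum => k m; rewrite vform_mono //.
have -> : poly_XaY (psi m *: 'X^k : {poly K}) = (lambda + mu) ^+ k * (psi m)%:P%:P.
  rewrite /poly_XaY -mul_polyC rmorphM rmorphXn /= map_polyX map_polyC /=.
  by rewrite comp_polyM comp_polyC rmorphXn /= comp_polyX mulrC (addrC 'X).
elim: k => [|k IH] /=; first by rewrite !vform_const // mul1r.
by rewrite [LHS]psi2D vform_mul_lambda vform_mul_mu IH -mulrDl exprS mulrA.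
Qed.

(** The 2-cocycle identity, obtained as the central coordinate of the Jacobi
identity.  In the extension the inner brackets contribute through their
[M]-component only, because [ext_bracket] ignores central components of its
arguments; this is why brackets of [M] remain. *)
Lemma cocycle_identity a b c :
  vform (alpha a) (br b c) =
  vsum (fun i m => lambda ^+ i * at_lambda_mu (alpha m c)) (br a b)
  + vsum (fun i m => lambda ^+ i * at_mu (alpha b m)) (br a c).
Proof.
have [_ [_ /(_ (a, 0) (b, 0) (c, 0)) /(congr1 psi2)]] := ext.
rewrite psi2D.
have -> : psi2 (br_lambda_mu E (a, 0) (b, 0) (c, 0)) = vform (alpha a) (br b c).
  have E0 : E (a, 0) 0 = 0 by exact: morphD0 (ext_bracketDr _).
  have a0 : alpha a 0 = 0 by exact: morphD0 (cocycleDr _).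
  rewrite vform_map //; apply/polyP => i; rewrite !vform_coef ?E0 //.
  by rewrite vform_ext_bracket ext_bracket_coef.
move=> ->; congr (_ + _).
  rewrite /br_left vsum_comp // [in RHS]brE vsum_map; last first.
    by move=> i x y; rewrite cocycleDl poly_XaYD mulrDr.
  apply: eq_vsum => i m.
  rewrite -(vform_ext_bracket m (c, 0)) -vform_subst_lambda_mu.
  elim: i => [|i IH] /=; first by rewrite mul1r.
  by rewrite vform_mul_lambda IH exprS mulrA.
rewrite /br_mu_lambda vsum_comp // [in RHS]brE vsum_map; last first.
  by move=> i x y; rewrite cocycleDr rmorphD mulrDr.
apply: eq_vsum => i m; have v0 : vmono i (0 : N) = 0 by exact: morphD0 (vmonoD _).
rewrite -(vform_ext_bracket (b, 0) m) vform_map //.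
apply/polyP => j; rewrite -polyC_exp coefCM coef_map /= !vform_coef ?v0 //.
by rewrite vform_mono // mulrC mul_polyC.
Qed.

End CentralExtension.

(** * Quadratic brackets *)

Section Quadratic.
Variables (K : comNzRingType) (V : lmodType K) (op lie : V -> V -> V).
Hypotheses (opL : bilinear_for *:%R *:%R op) (lieL : bilinear_for *:%R *:%R lie).

Local Notation br := (quad_bracket op lie).

Lemma vconstD : {morph @vconst V : x y / x + y}.
Proof. exact: vmonoD. Qed.

Lemma quad_bracket_const a b :
  br (vconst a) (vconst b) =
  vconst (vX (vconst (op a b)) + vconst (lie a b))
  + vX (vconst (vconst (op a b + op b a))).
Proof.
have op0l v : op 0 v = 0 by exact: morphD0 (linear_for_morphD (opL.1 v)).
have op0r v : op v 0 = 0 by exact: morphD0 (linear_for_morphD (opL.2 v)).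
have lie0l v : lie 0 v = 0 by exact: morphD0 (linear_for_morphD (lieL.1 v)).
have lie0r v : lie v 0 = 0 by exact: morphD0 (linear_for_morphD (lieL.2 v)).
have vX0 (W : zmodType) : vX (0 : vpoly W) = 0 by exact: morphD0 (@vXD W).
have vc0 (W : zmodType) : vconst (0 : W) = 0 by exact: morphD0 (@vmonoD W 0).
have gen0l v : quad_bracket_gen op lie 0 v = 0.
  by rewrite /quad_bracket_gen op0l op0r lie0l !(addr0, vc0, vX0).
have gen0r v : quad_bracket_gen op lie v 0 = 0.
  by rewrite /quad_bracket_gen op0l op0r lie0r !(addr0, vc0, vX0).
have iterD0 j : iter j (fun u : vpoly (vpoly V) => vmap (@vX V) u + vX u) 0 = 0.
  elim: j => //= j ->; rewrite vX0 addr0.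
  exact/morphD0/vmapD/vXD.
have iterN0 i : iter i (fun u : vpoly (vpoly V) => - vX u) 0 = 0.
  by elim: i => //= i ->; rewrite vX0 oppr0.
rewrite /quad_bracket vsum_mono => [|i]; last first.
  by rewrite vsum.unlock big1 // => j _; rewrite gen0l iterD0 iterN0.
rewrite vsum_mono => [/=|j]; last by rewrite gen0r iterD0 iterN0.
by rewrite /quad_bracket_gen addrAC; congr (_ + _); rewrite [RHS]vmonoD.
Qed.

(** All three terms of [cocycle_identity] and the coboundaries [vform phi] are
of the form [vsum f] of a bracket, so this evaluates each of them on [V]. *)
Lemma vsum_quad_bracket_const (W : zmodType) (f : nat -> vpoly V -> W) a b :
  (forall i, {morph f i : x y / x + y}) ->
  vsum f (br (vconst a) (vconst b)) =
  f 0 (vX (vconst (op a b))) + f 0 (vconst (lie a b))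
  + (f 1 (vconst (op a b)) + f 1 (vconst (op b a))).
Proof.
move=> fD; have f0 i : f i 0 = 0 by exact: morphD0.
rewrite quad_bracket_const vsumD // vsum_mono // fD.
have -> (p : vpoly V) : vX (vconst p) = vmono 1 p.
  by rewrite /vX vsum_mono // => j; apply: morphD0 (vmonoD _).
by rewrite vsum_mono // vconstD fD.
Qed.

Section Cocycle.
Variable alpha : vpoly V -> vpoly V -> {poly K}.
Hypothesis ext : is_leibniz_central_ext (@vX V) br alpha.
Local Notation alphaV := (fun a b : V => alpha (vconst a) (vconst b)).

Lemma quadratic_cocycle_identity a b c :
  (lambda + mu) * at_lambda (alphaV a (op b c))
  + mu * at_lambda (alphaV a (op c b))
  + at_lambda (alphaV a (lie b c))
  = - mu * at_lambda_mu (alphaV (op a b) c)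
    + lambda * at_lambda_mu (alphaV (op b a) c)
    + at_lambda_mu (alphaV (lie a b) c)
    + (lambda + mu) * at_mu (alphaV b (op a c))
    + lambda * at_mu (alphaV b (op c a))
    + at_mu (alphaV b (lie a c)).
Proof.
have := cocycle_identity ext (vconst a) (vconst b) (vconst c).
rewrite /vform vsum_quad_bracket_const => [|i x y]; last first.
  by rewrite (cocycleDr ext) scalerDl.
rewrite vsum_quad_bracket_const => [|i x y]; last first.
  by rewrite (cocycleDl ext) poly_XaYD mulrDr.
rewrite vsum_quad_bracket_const => [|i x y]; last first.
  by rewrite (cocycleDr ext) rmorphD mulrDr.
rewrite !(cocycle_Dl ext) !(cocycle_Dr ext).
rewrite -!mul_polyC !expr0 !expr1 !mulr1 !mul1r.
rewrite poly_XaY_N_MX !polyCM.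
rewrite ![map_poly polyC (_ * 'X)]rmorphM /= map_polyX => H.
apply/eqP; rewrite -subr_eq0; apply/eqP.
move/eqP: H; rewrite -subr_eq0 => /eqP <-.
ring.
Qed.
End Cocycle.
End Quadratic.

(** * The top coefficient *)

(** The ratio of the two sides is [2 (n - 2) / (3 (n - 1))], below [2 / 3]. *)
Lemma bin_sqr_gt n : (1 < n)%N -> (n * 'C(n, 3) < 'C(n, 2) * 'C(n, 2))%N.
Proof.
move=> n1; have C2 : (2 * 'C(n, 2) = n.-1 * n)%N by rewrite (mul_bin_left n 1) bin1 subn1.
have C3 : (3 * 'C(n, 3) = (n - 2) * 'C(n, 2))%N by rewrite (mul_bin_left n 2).
have : (0 < 'C(n, 2))%N by rewrite bin_gt0.
nia.
Qed.

(** The coefficient of λ^(k+2) μ^(j+2).  The hypothesis on [n] says that it has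
total degree [n + 1], where [A1] and [A2] contribute their coefficients of
degree [n] and [A3] none.  Each of the other terms has degree at most 1 in λ
or in μ, so both exponents are taken at least 2. *)
Lemma top_coef_eq (K : numDomainType) (n j k : nat)
    (A B C A1 A2 A3 B1 B2 B3 : {poly K}) :
  n = (j + k).+3 ->
  (size A3 <= n.+1)%N ->
  (lambda + mu) * at_lambda A + mu * at_lambda B + at_lambda C
  = - mu * at_lambda_mu A1 + lambda * at_lambda_mu A2 + at_lambda_mu A3
    + (lambda + mu) * at_mu B1 + lambda * at_mu B2 + at_mu B3 ->
  A1`_n *+ 'C(n, j.+1) = A2`_n *+ 'C(n, j.+2).
Proof.
move=> en sA3 /(congr1 (fun P : {poly {poly K}} => P`_j.+2`_k.+2)).
have nE1 : (k.+2 + j.+1)%N = n by rewrite en; lia.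
have nE2 : (k.+1 + j.+2)%N = n by rewrite en; lia.
have nE3 : (k.+2 + j.+2)%N = n.+1 by rewrite en; lia.
cbv beta; rewrite !mulrDl mulNr !(coefD, coefN, coefCM, coefXM, coefC) /=.
rewrite !(coef0, coef_map, coefC, coef_poly_XaY, nE1,nE2,nE3) /=.
rewrite [A3`__]nth_default // mul0rn !add0r !addr0 => /esym/eqP.
by rewrite addrC subr_eq0 => /eqP.
Qed.

(** The two relations used are [binom(n, 2) x = n y] and
[binom(n, 3) x = binom(n, 2) y]. *)
Lemma top_coef_eq0 (K : numDomainType) (n : nat) (A1 A2 : {poly K}) : (3 < n)%N ->
  (forall j k, n = (j + k).+3 -> A1`_n *+ 'C(n, j.+1) = A2`_n *+ 'C(n, j.+2)) ->
  A1`_n = 0.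
Proof.
case: n => [|[|[|[|n]]]] // _ H.
have C1 : 'C(n.+4, n.+3) = n.+4 by rewrite binSn.
have C2 : 'C(n.+4, n.+2) = 'C(n.+4, 2) by rewrite -(@bin_sub n.+4 2).
have C3 : 'C(n.+4, n.+1) = 'C(n.+4, 3) by rewrite -(@bin_sub n.+4 3).
have := H n.+1 0%N; rewrite addn0 C1 C2 => /(_ erefl) e2.
have := H n 1%N; rewrite addn1 C2 C3 => /(_ erefl) e3.
apply/eqP.
(* Eliminate A2 by multiplying e2 by binom(n, 2) and e3 by n. *)
have : A1`_n.+4 *+ ('C(n.+4, 2) * 'C(n.+4, 2) - n.+4 * 'C(n.+4, 3)) == 0.
  rewrite mulrnBr; last by apply/ltnW/bin_sqr_gt.
  by rewrite mulrnA e2 mulnC mulrnA e3 -!mulrnA mulnC subrr.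
by rewrite Num.Theory.mulrn_eq0 subn_eq0 leqNgt bin_sqr_gt.
Qed.

(** * Equivalence of cocycles *)

(** Sesquilinear forms on the free module [V[∂]] are determined by [V]. *)
Lemma conformal_form_ext (K : comNzRingType) (V : zmodType)
    (f g : vpoly V -> vpoly V -> {poly K}) :
  conformal_form (@vX V) f -> conformal_form (@vX V) g ->
  (forall a b, f (vconst a) (vconst b) = g (vconst a) (vconst b)) ->
  forall p q, f p q = g p q.
Proof.
move=> [fDl fDr fXl fXr] [gDl gDr gXl gXr] fg p q; move: p.
apply: vpoly_ind => [|p1 p2 IH1 IH2|a|p IH].
- by rewrite (morphD0 (fDl q)) (morphD0 (gDl q)).
- by rewrite fDl gDl IH1 IH2.
- move: q; apply: vpoly_ind => [|q1 q2 IH1 IH2|b|q IH] //.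
  + by rewrite (morphD0 (fDr _)) (morphD0 (gDr _)).
  + by rewrite fDr gDr IH1 IH2.
  + by rewrite fXr gXr IH.
- by rewrite fXl gXl IH.
Qed.

(** The linear form on [V] is the restriction of the one on [V[∂]]; conversely
a form on [V] extends by the constant term in ∂, as the functional must kill
the multiples of ∂. *)
Lemma quadratic_cocycle_equiv (K : comNzRingType) (V : lmodType K)
    (op lie : V -> V -> V) (alpha alpha' : vpoly V -> vpoly V -> {poly K}) :
  bilinear_for *:%R *:%R op -> bilinear_for *:%R *:%R lie ->
  is_leibniz_central_ext (@vX V) (quad_bracket op lie) alpha ->
  is_leibniz_central_ext (@vX V) (quad_bracket op lie) alpha' ->
  cocycle_equiv (@vX V) (quad_bracket op lie) alpha alpha' <->
  exists phi : {scalar V}, forall a b,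
    alpha (vconst a) (vconst b) = alpha' (vconst a) (vconst b)
      + phi (op a b + op b a) *: 'X + (phi (lie a b))%:P.
Proof.
move=> opL lieL ext ext'.
(* The term ∂(a ⊢ b) of the bracket is killed by such a functional. *)
have eval (Phi : vpoly V -> K) a b : {morph Phi : p q / p + q} ->
    (forall p, Phi (vX p) = 0) ->
    vform Phi (quad_bracket op lie (vconst a) (vconst b)) =
    Phi (vconst (op a b + op b a)) *: 'X + (Phi (vconst (lie a b)))%:P.
  move=> PhiD PhiX; rewrite /vform vsum_quad_bracket_const // => [|i x y].
    by rewrite PhiX scale0r add0r expr0 alg_polyC addrC -scalerDl -PhiD -vconstD.
  by rewrite PhiD scalerDl.
split=> [[Phi [PhiX PhiE]]|[phi phiE]].
  have phiL : GRing.linear_for *%R (fun a : V => Phi (vconst a)).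
    move=> c a b; have -> : vconst (c *: a + b) = c *: vconst a + vconst b.
      rewrite vconstD; congr (_ + _); apply/malgP => i.
      by rewrite vscale_coef !vmono_coef; case: ifP => //; rewrite scaler0.
    by rewrite linearP.
  pose phi : {scalar V} := HB.pack (fun a : V => Phi (vconst a))
    (GRing.isLinear.Build K V K *%R _ phiL).
  exists phi => a b.
  by rewrite PhiE -addrA -eval // => x y; rewrite raddfD.
have PhiL : GRing.linear_for *%R (fun p : vpoly V => phi p@_0%N).
  move=> c p q; rewrite mcoeffD raddfD /= [(c *: p)@__]vscale_coef.
  by rewrite linearZ.
pose Phi : {scalar vpoly V} := HB.pack (fun p : vpoly V => phi p@_0%N)
  (GRing.isLinear.Build K (vpoly V) K *%R _ PhiL).
exists Phi.
have PhiD : {morph (fun p : vpoly V => phi p@_0%N) : p q / p + q}.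
  by move=> p q; rewrite mcoeffD raddfD.
have PhiX (p : vpoly V) : phi (vX p)@_0%N = 0 by rewrite vX_coef raddf0.
split=> //; apply: conformal_form_ext => [||a b].
- exact: cocycle_conformal_form ext.
- apply: conformal_formD; first exact: cocycle_conformal_form ext'.
  have cob := coboundary_conformal_form ext PhiD PhiX.
  exact: cob.
by rewrite phiE -addrA [map_form _ _](eval _ a b PhiD PhiX) !vmono_coef.
Qed.

Theorem theorem4p8 (R : realType) (V : lmodType R[i]) (op lie : V -> V -> V)
    (HGD : is_gelfand_dorfman op lie)
    (alpha : vpoly V -> vpoly V -> {poly R[i]})
    (Halpha : is_leibniz_central_ext (@vX V) (quad_bracket op lie) alpha) :
  let alphaV := fun a b : V => alpha (vconst a) (vconst b) in
  (forall (n : nat) (alpha_ : nat -> V -> V -> R[i]),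
      (forall i, (i <= n)%N -> bilinear_for *%R *%R (alpha_ i)) ->
      (forall a b, alphaV a b = \sum_(i < n.+1) alpha_ i a b *: 'X^i) ->
      (exists a b, alpha_ n a b != 0) ->
      ((3 < n)%N -> forall a b c, alpha_ n (op a b) c = 0)
      /\
      ((n <= 3)%N ->
         (forall a b, alphaV a b =
            \sum_(i < 4) (if (i <= n)%N then alpha_ i a b else 0) *: 'X^i)
         /\
         (forall a b c,
            (lambda + mu) * at_lambda (alphaV a (op b c))
            + mu * at_lambda (alphaV a (op c b))
            + at_lambda (alphaV a (lie b c))
            = - mu * at_lambda_mu (alphaV (op a b) c)
              + lambda * at_lambda_mu (alphaV (op b a) c)
              + at_lambda_mu (alphaV (lie a b) c)
              + (lambda + mu) * at_mu (alphaV b (op a c))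
              + lambda * at_mu (alphaV b (op c a))
              + at_mu (alphaV b (lie a c)))))
  /\
  (forall alpha' : vpoly V -> vpoly V -> {poly R[i]},
      is_leibniz_central_ext (@vX V) (quad_bracket op lie) alpha' ->
      (cocycle_equiv (@vX V) (quad_bracket op lie) alpha alpha' <->
       exists phi : {scalar V},
         forall a b, alphaV a b =
           alpha' (vconst a) (vconst b)
           + phi (op a b + op b a) *: 'X + (phi (lie a b))%:P)).
Proof.
have opL := novikov_bilinear (gd_novikov HGD).
have lieL := lie_bilinear (gd_lie HGD).
move=> alphaV; split=> [n alpha_ _ alphaE _|alpha' Halpha']; last first.
  exact: (quadratic_cocycle_equiv opL lieL Halpha Halpha').
have coefE a b i : (alphaV a b)`_i = if (i <= n)%N then alpha_ i a b else 0.
  by rewrite alphaE -(poly_def n.+1 (fun i => alpha_ i a b)) coef_poly.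
have sizeV a b : (size (alphaV a b) <= n.+1)%N.
  by rewrite alphaE -(poly_def n.+1 (fun i => alpha_ i a b)) size_poly.
have identity := quadratic_cocycle_identity opL lieL Halpha.
split=> n3 => [a b c|].
  have := coefE (op a b) c n; rewrite leqnn => <-.
  apply: (top_coef_eq0 n3) => j k en.
  exact: top_coef_eq en (sizeV _ _) (identity a b c).
split=> // a b; apply/polyP => i.
rewrite -(poly_def 4 (fun i => if (i <= n)%N then alpha_ i a b else 0)).
rewrite coef_poly coefE; case: ltnP => // lt3i.
by rewrite leqNgt (leq_ltn_trans n3 lt3i).
Qed.
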